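(* Let $A$ be a graded vertex algebra with $sl_2$-structure over a field $\Bbbk$ of characteristic $0$ such that $\operatorname{rad}A=0$. Then: (1) $A_d=0$ for $d<0$. (2) $A_0$ is an associative commutative unital algebra with respect to the product $a\otimes b\mapsto ab=a(-1)b$, with unit $\mathbf 1$. (3) $A$ is a vertex algebra over the associative commutative algebra $A_0$; that is, $A_0$ acts on each component $A_d$ by $ab=a(-1)b$ ($a\in A_0$, $b\in A_d$), making it an $A_0$-module, and all structural maps of $A$ are $A_0$-linear: the products $(a,b)\mapsto a(m)b$ are $A_0$-bilinear for all $m\in\mathbb Z$, and $D,D^*:A\to A$ are $A_0$-linear. (4) Let $I\subset A$ be an ideal. Then $I\cap A_0=0$ if and only if $I=0$. (5) For any ideal $J_0\subset A_0$ the space $J_0A$ is an ideal of $A$ such that $J_0A\cap A_0=J_0$. It follows that $A$ is simple if and only if $A_0$ is a field.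
   Context: Vertex algebra: a $\Bbbk$-linear space $A$ with bilinear products $a\otimes b\mapsto a(n)b$ ($n\in\mathbb Z$) and an element $\mathbf 1\in A$ such that, with $Da=a(-2)\mathbf 1$ and divided powers $x^{(n)}=x^n/n!$ for $n\ge0$, $x^{(n)}=0$ for $n<0$: (i) $a(n)b=0$ for $n\gg0$; (ii) $\mathbf 1(n)a=\delta_{n,-1}a$ and $a(n)\mathbf 1=D^{(-n-1)}a$; (iii) $D(a(n)b)=(Da)(n)b+a(n)(Db)$ and $(Da)(n)b=-n\,a(n-1)b$; (iv) $a(m)(b(n)c)-b(n)(a(m)c)=\sum_{s\ge0}\binom ms (a(s)b)(m+n-s)c$, for all $a,b,c\in A$, $m,n\in\mathbb Z$. The same definition makes sense over any commutative ring containing $\mathbb Q$. Graded with $sl_2$-structure: $A=\bigoplus_{d\in\mathbb Z}A_d$ with $A_i(n)A_j\subseteq A_{i+j-n-1}$, $\mathbf 1\in A_0$, together with a locally nilpotent operator $D^*:A\to A$ of degree $-1$ with $D^*\mathbf 1=0$ and $[D^*,a(m)]=(2d-m-2)\,a(m+1)+(D^*a)(m)$ for all $a\in A_d$, $m\in\mathbb Z$, where $a(m)$ is the operator $b\mapsto a(m)b$. Ideals of $A$ are two-sided ideals for all products $(n)$ that are stable under $D$ and $D^*$ (hence homogeneous, since they are then stable under the grading derivation). $A$ is simple if it has no ideals (in this $D^*$-invariant sense) other than $0$ and $A$, with $A\ne0$. For subspaces $X,Y\subseteq A$, $X(-1)Y$ denotes the span of all $x(-1)y$; $J_0A$ is the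 span of all $a(-1)b$, $a\in J_0$, $b\in A$. For homogeneous $a\in A$ and $m\in\mathbb Z$ put $a(m)^*=(-1)^{\deg a}\sum_{i\ge 0}(D^{*(i)}a)(2\deg a-m-2-i)$, an operator on $A$, extended linearly in $a$. A bilinear form $\langle\cdot|\cdot\rangle$ on $A$ with values in a vector space $V$ is invariant if $\langle a(m)b|c\rangle=\langle b|a(m)^*c\rangle$ and $\langle Da|b\rangle=\langle a|D^*b\rangle$ for all $a,b,c\in A$, $m\in\mathbb Z$. For each linear map $f:A_0\to V$ with $f(D^*A_1)=0$ there is a unique $V$-valued invariant bilinear form with $\langle\mathbf 1|a\rangle=f(a)$ for $a\in A_0$; explicitly $\langle a|b\rangle=f(a(-1)^*b)$ if $a,b$ are homogeneous of the same degree and $\langle a|b\rangle=0$ if they are homogeneous of different degrees. This form is symmetric. The radical $\operatorname{rad}A$ is the radical $\{a\in A:\langle a|b\rangle=0\ \forall b\in A\}$ of the invariant form corresponding to the canonical projection $f:A_0\to A_0/A_0(-1)D^*A_1$; it is an ideal of $A$. *)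

(* Defs.v *)
From HB Require Import structures.
From mathcomp Require Import all_boot all_order all_algebra.
From mathcomp Require Import boolp classical_sets functions cardinality fsbigop.

Set Implicit Arguments.
Unset Strict Implicit.
Unset Printing Implicit Defensive.

Import Order.TTheory GRing.Theory Num.Theory.

Local Open Scope classical_set_scope.
Local Open Scope ring_scope.
Local Open Scope quotient_scope.

(* Every sum over all of nat or int below is a finitely supported sum,
   [\sum_(i \in [set: _])]. Where it occurs in an axiom or in a definition, the
   support is finite by locality, by local nilpotence of D^* or by the
   direct sum axiom. *)

Section LinearAlgebra.
Variables (k : fieldType) (A : lmodType k).

Definition subspace (X : set A) : Prop :=
  X 0 /\ forall (c : k) x y, X x -> X y -> X (c *: x + y).

Definition lspan (G : set A) : set A := smallest subspace G.

Lemma subspace_lspan (G : set A) : subspace (lspan G).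
Proof.
split=> [W [[]//]|c x y Gx Gy W WG].
by have [[_ WZD] _] := WG; apply: WZD; [apply: Gx|apply: Gy].
Qed.

Lemma subspaceP (X : set A) : subspace X -> submod_closed [pred x | x \in X].
Proof.
by case=> X0 XZD; split=> [|c x y] /=; rewrite !inE//; exact: XZD.
Qed.

(* D^(n) = D^n / n! for n >= 0 and D^(n) = 0 for n < 0 *)
Definition divpow (D : A -> A) (n : int) (a : A) : A :=
  if n is Posz m then (m`!%:R : k)^-1 *: iter m D a else 0.

End LinearAlgebra.

Definition binz (k : fieldType) (m : int) (s : nat) : k :=
  (\prod_(i < s) (m - i%:Z)%:~R) / s`!%:R.

Section LmodQuotient.
Variables (k : fieldType) (A : lmodType k) (S : submodClosed A).

(* S again, as a predicate with the zmodClosed instance that a submodClosed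
   predicate over a ring (as opposed to a semiring) has. *)
Definition lquot_pred : {pred A} := S.

Fact lquot_pred_closed : submod_closed lquot_pred.
Proof. by split=> [|c x y Sx Sy]; rewrite ?rpred0// rpredD// rpredZ. Qed.

HB.instance Definition _ := GRing.isSubmodClosed.Build k A lquot_pred
  lquot_pred_closed.

Definition lquot : Type := {ideal_quot lquot_pred}.
HB.instance Definition _ := GRing.Zmodule.on lquot.

Definition lquot_pi (x : A) : lquot := \pi_({ideal_quot lquot_pred}) x.
Definition lquot_scale (c : k) (q : lquot) : lquot :=
  lquot_pi (c *: repr (q : {ideal_quot lquot_pred})).

Lemma lquot_piD : {morph lquot_pi : x y / x + y}.
Proof. by move=> x y; rewrite /lquot_pi raddfD. Qed.

Lemma lquot_pi_eq x y : (lquot_pi x == lquot_pi y) = (x - y \in S).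
Proof. exact/esym/(Quotient.idealrBE lquot_pred). Qed.

Lemma lquot_piZ c x : lquot_pi (c *: x) = lquot_scale c (lquot_pi x).
Proof.
apply/eqP; rewrite /lquot_scale lquot_pi_eq -scalerBr rpredZ//.
by rewrite -lquot_pi_eq /lquot_pi reprK.
Qed.

Lemma lquot_piP (q : lquot) : exists x, q = lquot_pi x.
Proof. by exists (repr (q : {ideal_quot lquot_pred})); rewrite /lquot_pi reprK. Qed.

Lemma lquot_scaleA a b q :
  lquot_scale a (lquot_scale b q) = lquot_scale (a * b) q.
Proof. by have [x ->] := lquot_piP q; rewrite -!lquot_piZ scalerA. Qed.

Lemma lquot_scale1 : left_id 1 lquot_scale.
Proof. by move=> q; have [x ->] := lquot_piP q; rewrite -lquot_piZ scale1r. Qed.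

Lemma lquot_scaleDr : right_distributive lquot_scale +%R.
Proof.
move=> c q r; have [x ->] := lquot_piP q; have [y ->] := lquot_piP r.
by rewrite -lquot_piD -!lquot_piZ -lquot_piD scalerDr.
Qed.

Lemma lquot_scaleDl q : {morph lquot_scale^~ q : a b / a + b}.
Proof.
by move=> a b; have [x ->] := lquot_piP q; rewrite -!lquot_piZ -lquot_piD scalerDl.
Qed.

HB.instance Definition _ := GRing.Zmodule_isLmodule.Build k lquot
  lquot_scaleA lquot_scale1 lquot_scaleDr lquot_scaleDl.

Lemma lquot_pi_linear : linear lquot_pi.
Proof. by move=> c x y; rewrite lquot_piD lquot_piZ. Qed.

HB.instance Definition _ := GRing.isLinear.Build k A lquot _ lquot_pi
  lquot_pi_linear.

End LmodQuotient.

(* [Y n a b] is a(n)b, [one] is the vacuum, and D a = a(-2)1. *)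
Record vertex_axioms (k : fieldType) (A : lmodType k)
    (Y : int -> A -> A -> A) (one : A) (D := fun a => Y (- 2) a one) : Prop := {
  va_linearl : forall n b, linear (Y n ^~ b);
  va_linearr : forall n a, linear (Y n a);
  va_local : forall a b, exists N : int, forall n, N <= n -> Y n a b = 0;
  va_onel : forall n a, Y n one a = if n == - 1 then a else 0;
  va_oner : forall n a, Y n a one = divpow D (- n - 1) a;
  va_D_derivation : forall n a b, D (Y n a b) = Y n (D a) b + Y n a (D b);
  va_Dl : forall n a b, Y n (D a) b = - n%:~R *: Y (n - 1) a b;
  va_commutator : forall m n a b c,
    Y m a (Y n b c) - Y n b (Y m a c) =
    \sum_(s \in [set: nat]) binz k m s *: Y (m + n - s%:Z) (Y s%:Z a b) c
}.

Record vertexAlgebra (k : fieldType) := VertexAlgebra {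
  va_sort :> lmodType k;
  vprod : int -> va_sort -> va_sort -> va_sort;
  vone : va_sort;
  va_axioms : vertex_axioms vprod vone
}.
Arguments vone {k} A : rename.

Definition vD (k : fieldType) (A : vertexAlgebra k) (a : A) : A :=
  vprod (- 2) a (vone A).

Record sl2_axioms (k : fieldType) (A : vertexAlgebra k)
    (gr : int -> set A) (Ds : A -> A) : Prop := {
  gr_subspace : forall d, subspace (gr d);
  gr_direct : forall a : A, exists! x : int -> A,
    [/\ forall d, gr d (x d), finite_set [set d | x d <> 0]
      & a = \sum_(d \in [set: int]) x d];
  gr_prod : forall i j n a b,
    gr i a -> gr j b -> gr (i + j - n - 1) (vprod n a b);
  gr_one : gr 0 (vone A);
  Dstar_linear : linear Ds;
  Dstar_nilp : forall a, exists n : nat, iter n Ds a = 0;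
  Dstar_gr : forall d a, gr d a -> gr (d - 1) (Ds a);
  Dstar_one : Ds (vone A) = 0;
  Dstar_commutator : forall d m a b, gr d a ->
    Ds (vprod m a b) - vprod m a (Ds b) =
    (2 * d - m - 2)%:~R *: vprod (m + 1) a b + vprod m (Ds a) b
}.

Record sl2VertexAlgebra (k : fieldType) := Sl2VertexAlgebra {
  sl2_va :> vertexAlgebra k;
  gr : int -> set sl2_va;
  Dstar : sl2_va -> sl2_va;
  sl2_ax : sl2_axioms gr Dstar
}.
Arguments gr {k} A d : rename.

Section Components.
Variables (k : fieldType) (A : sl2VertexAlgebra k).

Definition component (a : A) : int -> A :=
  projT1 (cid (gr_direct (sl2_ax A) a)).

Lemma component_gr (a : A) d : gr A d (component a d).
Proof. by rewrite /component; case: cid => x /= [[]]. Qed.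

(* A_0 as a vector space in its own right *)
Definition deg0_pred : {pred A} := [pred x | x \in gr A 0].

Fact deg0_pred_closed : submod_closed deg0_pred.
Proof. exact: subspaceP (gr_subspace (sl2_ax A) 0). Qed.

HB.instance Definition _ := GRing.isSubmodClosed.Build k A deg0_pred
  deg0_pred_closed.

Record deg0 := Deg0 { deg0_val :> A; deg0_valP : deg0_val \in deg0_pred }.

HB.instance Definition _ := [isSub for deg0_val].
HB.instance Definition _ := [Choice of deg0 by <:].
HB.instance Definition _ := [SubChoice_isSubLmodule of deg0 by <:].

Definition proj0 (a : A) : deg0 := Deg0 (mem_set (component_gr a 0)).

End Components.

Section InvariantForm.
Variables (k : fieldType) (A : sl2VertexAlgebra k).

(* a(m)^* b for a homogeneous of degree d, and its linear extension *)
Definition adj_homog (d m : int) (a b : A) : A :=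
  ((- 1) ^ d : k) *: \sum_(i \in [set: nat])
    vprod (2 * d - m - 2 - i%:Z) (divpow (@Dstar k A) i%:Z a) b.

Definition adj (m : int) (a b : A) : A :=
  \sum_(d \in [set: int]) adj_homog d m (component a d) b.

(* The V-valued invariant form attached to f : A_0 -> V: it is f(a(-1)^* b) for
   a and b homogeneous of the same degree (a(-1)^* b is then in A_0), and
   vanishes on pairs of homogeneous elements of different degrees. *)
Definition inv_form (V : lmodType k) (f : {linear deg0 A -> V}) (a b : A) : V :=
  \sum_(d \in [set: int])
    f (proj0 (adj (- 1) (component a d) (component b d))).

Definition form_radical (V : lmodType k) (B : A -> A -> V) : set A :=
  [set a | forall b, B a b = 0].

(* X(-1)Y *)
Definition prod_span (X Y : set A) : set A :=
  lspan [set vprod (- 1) x y | x in X & y in Y].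

(* A_0(-1)D^*A_1, first as a subset of A, then as a subspace of the type A_0 *)
Definition rad_sub : set A := prod_span (gr A 0) (@Dstar k A @` gr A 1).

Definition rad_pred : {pred deg0 A} := [pred x | deg0_val x \in rad_sub].

Fact rad_pred_closed : submod_closed rad_pred.
Proof.
have [W0 WZD] := subspaceP (subspace_lspan
  [set vprod (- 1) x y | x in gr A 0 & y in @Dstar k A @` gr A 1]).
by split=> [|c x y Wx Wy]; [exact: W0|exact: WZD].
Qed.

HB.instance Definition _ := GRing.isSubmodClosed.Build k (deg0 A) rad_pred
  rad_pred_closed.

(* the canonical projection A_0 -> A_0 / A_0(-1)D^*A_1 *)
Definition rad_proj : {linear deg0 A -> lquot rad_pred} :=
  @lquot_pi k (deg0 A) rad_pred.

Definition radical : set A := form_radical (inv_form rad_proj).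

End InvariantForm.
Arguments radical {k} A.

Section Ideals.
Variables (k : fieldType) (A : sl2VertexAlgebra k).

Record va_ideal (I : set A) : Prop := {
  ideal_subspace : subspace I;
  ideal_prodl : forall n a b, I b -> I (vprod n a b);
  ideal_prodr : forall n a b, I a -> I (vprod n a b);
  ideal_D : forall a, I a -> I (vD a);
  ideal_Dstar : forall a, I a -> I (Dstar a)
}.

Definition va_simple : Prop :=
  (exists a : A, a <> 0) /\
  forall I : set A, va_ideal I -> I = [set 0] \/ I = [set: A].

(* Bilinearity over k of the product of A_0 is part of [vertex_axioms]. *)
Record deg0_com_algebra : Prop := {
  deg0_sub : subspace (gr A 0);
  deg0_mul_closed : forall a b, gr A 0 a -> gr A 0 b -> gr A 0 (vprod (- 1) a b);
  deg0_mulA : forall a b c, gr A 0 a -> gr A 0 b -> gr A 0 c ->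
    vprod (- 1) a (vprod (- 1) b c) = vprod (- 1) (vprod (- 1) a b) c;
  deg0_mulC : forall a b, gr A 0 a -> gr A 0 b ->
    vprod (- 1) a b = vprod (- 1) b a;
  deg0_one : gr A 0 (vone A);
  deg0_mul1 : forall a, gr A 0 a ->
    vprod (- 1) (vone A) a = a /\ vprod (- 1) a (vone A) = a
}.

Definition deg0_field : Prop :=
  [/\ deg0_com_algebra, vone A <> 0
    & forall a, gr A 0 a -> a <> 0 ->
        exists2 b, gr A 0 b & vprod (- 1) a b = vone A].

Record deg0_ideal (J : set A) : Prop := {
  deg0_ideal_sub : J `<=` gr A 0;
  deg0_ideal_subspace : subspace J;
  deg0_ideal_mul : forall a x, gr A 0 a -> J x -> J (vprod (- 1) a x)
}.

(* Each A_d is an A_0-module under ab = a(-1)b. *)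
Record deg0_module (d : int) : Prop := {
  deg0_act_closed : forall a b, gr A 0 a -> gr A d b -> gr A d (vprod (- 1) a b);
  deg0_actDl : forall a a' b, gr A 0 a -> gr A 0 a' -> gr A d b ->
    vprod (- 1) (a + a') b = vprod (- 1) a b + vprod (- 1) a' b;
  deg0_actDr : forall a b b', gr A 0 a -> gr A d b -> gr A d b' ->
    vprod (- 1) a (b + b') = vprod (- 1) a b + vprod (- 1) a b';
  deg0_actA : forall a a' b, gr A 0 a -> gr A 0 a' -> gr A d b ->
    vprod (- 1) (vprod (- 1) a a') b = vprod (- 1) a (vprod (- 1) a' b);
  deg0_act1 : forall b, gr A d b -> vprod (- 1) (vone A) b = b
}.

Definition deg0_linear (phi : A -> A) : Prop :=
  {morph phi : x y / x + y} /\
  forall a x, gr A 0 a -> phi (vprod (- 1) a x) = vprod (- 1) a (phi x).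

Record vertex_algebra_over_deg0 : Prop := {
  over_deg0_module : forall d, deg0_module d;
  over_deg0_linearl : forall m b, deg0_linear (vprod m ^~ b);
  over_deg0_linearr : forall m a, deg0_linear (vprod m a);
  over_deg0_D : deg0_linear (@vD k A);
  over_deg0_Dstar : deg0_linear (@Dstar k A)
}.

End Ideals.
Arguments va_simple {k} A.
Arguments deg0_com_algebra {k} A.
Arguments deg0_field {k} A.
Arguments vertex_algebra_over_deg0 {k} A.

(* Main.v *)
(* Write N for A_0(-1)D^*A_1 and <a|b> for the class of a(-1)^* b modulo N. For u
   in A_0 every term of u(-1)^* is (D^(i) D^*^(i) u)(-1), so A_0 is orthogonal to
   D^*A_1. In negative degrees sl_2 theory and local nilpotence of D^* make D^* D
   surjective, hence A_d = D^*^(1-d) A_1 for d < 0, and <Da|b> = <a|D^*b> moves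
   the pairing on A_d to one between A_0 and D^*A_1: thus A_d lies in the radical
   and vanishes. Then A_0 is commutative, so D^*A_1 is in the radical, and finally
   so is DA_0. Elements a of A_0 therefore satisfy a(n) = 0 for n <> -1, which
   makes every structure map A_0-linear. Since <a|b> for a in an ideal I is the
   class of an element of I in A_0, the ideals of A are controlled by A_0. *)
Require Import Defs.
From HB Require Import structures.
From mathcomp Require Import all_boot all_order all_algebra finmap.
From mathcomp Require Import boolp classical_sets functions cardinality fsbigop.
From mathcomp Require Import ring zify.
Import Order.TTheory GRing.Theory Num.Theory.
Local Open Scope classical_set_scope.
Local Open Scope ring_scope.

Set Implicit Arguments.
Unset Strict Implicit.
Unset Printing Implicit Defensive.

(** * Characteristic zero, finitely supported sums and subspaces *)

Lemma pchar0_intr_eq0 (R : idomainType) :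
  [pchar R] =i pred0 -> forall z : int, (z%:~R == 0 :> R) = (z == 0).
Proof.
move=> /pcharf0P char0 [n|n]; first by rewrite -pmulrn char0.
by rewrite NegzE mulrNz oppr_eq0 -pmulrn char0.
Qed.

Lemma fsbig_nat_ord (V : nmodType) (N : nat) (F : nat -> V) :
  (forall i, (N <= i)%N -> F i = 0) ->
  \sum_(i \in [set: nat]) F i = \sum_(i < N) F i.
Proof.
move=> F0; rewrite fsbig_ord; apply/esym/fsbig_widen => //= i [_ /negP].
by rewrite -leqNgt => /F0.
Qed.

Section Subspace.
Variables (k : fieldType) (V : lmodType k) (X : set V).
Hypothesis sX : subspace X.

Lemma subspace0 : X 0. Proof. by case: sX. Qed.

Lemma subspaceZ c x : X x -> X (c *: x).
Proof. by move=> Xx; rewrite -[_ *: _]addr0; apply: sX.2 => //; exact: subspace0. Qed.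

Lemma subspaceD x y : X x -> X y -> X (x + y).
Proof. by move=> Xx Xy; rewrite -[x]scale1r; exact: sX.2. Qed.

Lemma subspaceB x y : X x -> X y -> X (x - y).
Proof. by move=> Xx Xy; rewrite -scaleN1r addrC; exact: sX.2. Qed.

Lemma subspace_sum (I : Type) (r : seq I) (P : pred I) (F : I -> V) :
  (forall i, P i -> X (F i)) -> X (\sum_(i <- r | P i) F i).
Proof. by move=> XF; apply: big_ind => //; [exact: subspace0|exact: subspaceD]. Qed.

Lemma lspan_min (G : set V) : G `<=` X -> lspan G `<=` X.
Proof. by move=> GX x; apply. Qed.

End Subspace.

Lemma sub_lspan (k : fieldType) (V : lmodType k) (G : set V) : G `<=` lspan G.
Proof. by move=> x Gx W [_]; apply. Qed.

Lemma iter_linear (k : fieldType) (V : lmodType k) (f : {linear V -> V}) n :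
  linear (iter n f).
Proof. by move=> c x y; elim: n => //= n ->; rewrite linearP. Qed.

Lemma divpow0 (k : fieldType) (V : lmodType k) (f : V -> V) x : divpow f 0 x = x.
Proof. by rewrite /divpow /= fact0 invr1 scale1r. Qed.

(** * Products in a vertex algebra *)

Section VertexAlgebra.
Variables (k : fieldType) (A : vertexAlgebra k).
Hypothesis char0 : [pchar k] =i pred0.
Implicit Types (a b x y : A) (m n : int).

Local Notation D := (@vD k A).
Local Notation Y := (@vprod k A).

HB.instance Definition _ n a := GRing.isLinear.Build k A A _ (Y n a)
  (va_linearr (va_axioms A) n a).

HB.instance Definition _ := GRing.isLinear.Build k A A _ D
  (va_linearl (va_axioms A) (- 2) (vone A)).

Lemma vprodDl n b : {morph Y n ^~ b : a a' / a + a'}.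
Proof.
by move=> a a'; have := va_linearl (va_axioms A) n b 1 a a'; rewrite !scale1r.
Qed.

Lemma vprod0l n b : Y n 0 b = 0.
Proof.
have := va_linearl (va_axioms A) n b (-1) 0 0.
by rewrite !scaleN1r addr0 oppr0 addNr.
Qed.

Lemma vprodZl n b c a : Y n (c *: a) b = c *: Y n a b.
Proof.
by have := va_linearl (va_axioms A) n b c a 0; rewrite vprod0l !addr0.
Qed.

Lemma vprod_1one a : Y (- 1) (vone A) a = a.
Proof. by rewrite (va_onel (va_axioms A)) eqxx. Qed.

Lemma vprod_one n a : Y n a (vone A) = divpow D (- n - 1) a.
Proof. exact: va_oner (va_axioms A) n a. Qed.

Lemma vprodN1_one a : Y (- 1) a (vone A) = a.
Proof. by rewrite vprod_one divpow0. Qed.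

Lemma vprod_Dl n a b : Y n (D a) b = (- n)%:~R *: Y (n - 1) a b.
Proof. by rewrite (va_Dl (va_axioms A)) mulrNz. Qed.

(** Moving each [D] off the left argument lowers the mode by one; starting from mode -1, the factors
    1, ..., i multiply to i!, which the divided power cancels. *)
Lemma vprod_divpow_Dl (i : nat) a b :
  Y (- 1) (divpow D i a) b = Y (- 1 - i%:Z) a b.
Proof.
rewrite vprodZl; apply: (canLR (scalerK _)).
  by rewrite ((pcharf0P _).1 char0) -lt0n fact_gt0.
elim: i a => [|i IH] a; first by rewrite fact0 scale1r subr0.
rewrite iterSr IH vprod_Dl scalerA factS natrM mulrC; congr (_ *: Y _ _ _); last by lia.
by rewrite [in RHS]pmulrn; congr (_%:~R * _); lia.
Qed.

Lemma vprod_locality a b :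
  exists N : nat, forall i : nat, (N <= i)%N -> Y i a b = 0.
Proof.
have [N HN] := va_local (va_axioms A) a b.
by exists `|N|%N => i Ni; apply: HN; lia.
Qed.

(* The commutator formula applied to the vacuum recovers a product from the
   opposite ones. *)
Lemma vprod_skew m a b (N : nat) : (forall i : nat, (N <= i)%N -> Y i b a = 0) ->
  Y m a b = Y (- 1) b (Y m a (vone A)) -
    \sum_(s < N) binz k (- 1) s *: Y (- 1 + m - s%:Z) (Y s b a) (vone A).
Proof.
move=> HN; have := va_commutator (va_axioms A) (- 1) m b a (vone A).
rewrite vprodN1_one (@fsbig_nat_ord _ N) => [<-|i /HN ->]; first by rewrite subKr.
by rewrite vprod0l scaler0.
Qed.

(** * Multiplication by elements killed by [D] *)

Section Constant.

Variable a : A.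
Hypothesis Da0 : D a = 0.

(** The rule for [D a] in mode n + 1 gives 0 = -(n + 1) a(n)b, and n + 1 is invertible in [k]. *)
Lemma vprod_const n b : n != - 1 -> Y n a b = 0.
Proof.
move=> n1; have := vprod_Dl (n + 1) a b; rewrite Da0 vprod0l addrK => /esym/eqP.
rewrite scaler_eq0 (pchar0_intr_eq0 char0) => /orP[/eqP|/eqP//].
by move: n1 => /[swap]; lia.
Qed.

(** The commutator formula only involves a(s)b with s >= 0, all of them zero. *)
Lemma const_comm m b x : Y m b (Y (- 1) a x) = Y (- 1) a (Y m b x).
Proof.
apply/eqP; rewrite eq_sym -subr_eq0 (va_commutator (va_axioms A)) fsbig1// => s _.
by rewrite vprod_const ?vprod0l ?scaler0//; lia.
Qed.

Lemma const_D x : D (Y (- 1) a x) = Y (- 1) a (D x).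
Proof. by rewrite [LHS](va_D_derivation (va_axioms A)) -/(D a) Da0 vprod0l add0r. Qed.

Lemma const_one m x : Y m (Y (- 1) a x) (vone A) = Y (- 1) a (Y m x (vone A)).
Proof.
rewrite !vprod_one; case: (- m - 1) => [j|j] /=; last by rewrite linear0.
rewrite linearZ/=; congr (_ *: _).
by elim: j => //= j ->; rewrite const_D.
Qed.

(** [vprod_skew] writes both sides through modes of [y] and values at the vacuum, and a(-1) passes
    through each of these. *)
Lemma const_assoc m x y : Y m (Y (- 1) a x) y = Y (- 1) a (Y m x y).
Proof.
have [N HN] := vprod_locality y x.
(* The locality bound for [y] and [x] also serves for [y] and a(-1)x, since a(-1) commutes with the
   modes of [y]. *)
rewrite (vprod_skew _ HN) (@vprod_skew _ _ _ N) => [|i /HN yx0]; last first.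
  by rewrite const_comm yx0 linear0.
rewrite linearB/= [X in _ = _ - X]linear_sum/= const_one const_comm; congr (_ - _).
by apply: eq_bigr => s _; rewrite linearZ/= const_comm const_one.
Qed.

End Constant.
End VertexAlgebra.

(** * The grading and the sl_2 relations between [D] and [E] = D^* *)

Section Graded.
Variables (k : fieldType) (A : sl2VertexAlgebra k).
Hypothesis char0 : [pchar k] =i pred0.
Implicit Types (a b x y : A) (d m n : int).
Local Arguments divpow : simpl never.

Local Notation D := (@vD k A).
Local Notation E := (@Dstar k A).
Local Notation Y := (@vprod k A).

HB.instance Definition _ := GRing.isLinear.Build k A A _ E
  (Dstar_linear (sl2_ax A)).

Lemma gr_sub d : subspace (gr A d). Proof. exact: gr_subspace (sl2_ax A) d. Qed.

Lemma gr_vprod i j n e a b : gr A i a -> gr A j b -> i + j - n - 1 = e ->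
  gr A e (Y n a b).
Proof. by move=> ia jb <-; exact: gr_prod (sl2_ax A) _ _ _ _ _ ia jb. Qed.

Lemma gr_D d a : gr A d a -> gr A (d + 1) (D a).
Proof. by move=> da; apply: (gr_vprod da (gr_one (sl2_ax A))); lia. Qed.

Lemma gr_E d a : gr A d a -> gr A (d - 1) (E a).
Proof. exact: Dstar_gr (sl2_ax A) d a. Qed.

Lemma gr_iterE d i a : gr A d a -> gr A (d - i%:Z) (iter i E a).
Proof.
move=> da; elim: i => [|i IH] /=; first by rewrite subr0.
by have := gr_E IH; congr gr; lia.
Qed.

Lemma gr_divpowE d (i : nat) a : gr A d a -> gr A (d - i%:Z) (divpow E i a).
Proof. by move=> da; apply: (subspaceZ (gr_sub _)); exact: gr_iterE. Qed.

Lemma E_vprod d m a b : gr A d a ->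
  E (Y m a b) =
  Y m a (E b) + (2 * d - m - 2)%:~R *: Y (m + 1) a b + Y m (E a) b.
Proof.
move=> da; apply/eqP; rewrite -addrA addrC -subr_eq; apply/eqP.
exact: Dstar_commutator (sl2_ax A) _ _ _ _ da.
Qed.

(** The sl_2 relation [D^*, D] = 2d on A_d: the commutator axiom in mode -2, applied to the
    vacuum. *)
Lemma E_D d a : gr A d a -> E (D a) = D (E a) + (2 * d)%:~R *: a.
Proof.
move=> da; rewrite /vD (E_vprod _ _ da) (Dstar_one (sl2_ax A)) linear0 add0r.
by rewrite vprodN1_one addrC; congr (_ + _%:~R *: _); lia.
Qed.

Lemma iterE_eq0 a (N i : nat) : (N <= i)%N -> iter N E a = 0 -> iter i E a = 0.
Proof. by move=> Ni a0; rewrite -(subnK Ni) iterD a0 iter_fix// linear0. Qed.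

Lemma divpowE_eq0 a (N i : nat) :
  (N <= i)%N -> iter N E a = 0 -> divpow E i a = 0.
Proof. by move=> Ni a0; rewrite /divpow (iterE_eq0 Ni a0) scaler0. Qed.

Lemma divpowE_S (i : nat) a : E (divpow E i a) = i.+1%:R *: divpow E i.+1 a.
Proof.
have n0 := (pcharf0P _).1 char0.
by rewrite /divpow linearZ scalerA factS natrM invfM mulVKf ?n0.
Qed.

(** Induction from [E_D]: one more D^* gives the coefficient 2(d - i - 1) + (2d - i)(i + 1) = (i +
    2)(2d - i - 1), and i + 2 cancels in characteristic 0. *)
Lemma divpowE_D d (i : nat) a : gr A d a ->
  divpow E i.+1 (D a) =
  D (divpow E i.+1 a) + (2 * d - i%:Z)%:~R *: divpow E i a.
Proof.
have n0 := (pcharf0P _).1 char0.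
move=> da; elim: i => [|i IH].
  by rewrite /divpow /= !fact0 (_ : 1`! = 1%N)// !invr1 !scale1r (E_D da) subr0.
apply: (scalerI (a := i.+2%:R)); first by rewrite n0.
rewrite -divpowE_S IH linearD/= (E_D (gr_divpowE i.+1 da)) divpowE_S.
rewrite linearZ/= [E (_ *: _)]linearZ/= divpowE_S.
move: (D _) (divpow E i.+1 a) => Da1 a1.
rewrite scalerDr !scalerA -addrA -scalerDl.
congr (_ + _ *: _).
rewrite -[i.+1%:R]/(i.+1%:~R) -[i.+2%:R]/(i.+2%:~R) -!intrM -intrD.
by congr (_%:~R); lia.
Qed.

Lemma Dstar_nilpotent a : exists N : nat, iter N E a = 0.
Proof. exact: Dstar_nilp (sl2_ax A) a. Qed.

Lemma iterE_divpow (i : nat) a : iter i E a = i`!%:R *: divpow E i a.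
Proof.
by rewrite /divpow scalerA mulfV ?scale1r// ((pcharf0P _).1 char0) -lt0n fact_gt0.
Qed.

(* On A_d with d < 0 the operator D^* D is triangular with respect to the
   filtration by the kernels of the powers D^*^(n+1), with nonzero diagonal
   entries (n + 1)(2d - n). *)
Lemma neg_ED_surj d a : d < 0 -> gr A d a -> exists2 b, gr A d b & a = E (D b).
Proof.
move=> d0; have [N] := Dstar_nilpotent a; elim: N a => [|N IH] a aN da.
  by exists 0; [exact: subspace0 (gr_sub d)|rewrite [a]aN !linear0].
pose c : k := (N.+1%:Z * (2 * d - N%:Z))%:~R.
have cV : c^-1 * c = 1 by rewrite mulVf// (pchar0_intr_eq0 char0); nia.
have dED : gr A d (E (D a)) by have := gr_E (gr_D da); rewrite addrK.
have dB : gr A d (- c^-1 *: E (D a) + a).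
  by apply: subspaceD (gr_sub d) _ _ _ da; exact: subspaceZ (gr_sub d) _ _ _.
(* Subtracting c^-1 D^* D a cancels the top term, so the remainder is killed one power of D^*
   earlier. *)
have iter0 : iter N E (- c^-1 *: E (D a) + a) = 0.
  rewrite iter_linear -iterSr iterE_divpow (divpowE_D N da).
  rewrite (divpowE_eq0 (leqnn _) aN) linear0 add0r [iter N E a]iterE_divpow.
  move: (divpow E N a) => e; rewrite !scalerA -scalerDl factS natrM -!mulrA.
  rewrite (_ : N.+1%:R * _ = c * N`!%:R); last by rewrite /c intrM; ring.
  by rewrite mulrA mulNr cV mulN1r addNr scale0r.
have [b db abE] := IH _ iter0 dB.
exists (c^-1 *: a + b).
  by apply: subspaceD (gr_sub d) _ _ _ db; exact: subspaceZ (gr_sub d) _ _ _.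
by rewrite !linearP/= -abE scaleNr addrA subrr add0r.
Qed.

(** * The adjoint operators on homogeneous elements *)

Lemma adj_homogE (N : nat) d m a b : iter N E a = 0 ->
  adj_homog d m a b =
  ((- 1) ^ d : k) *: \sum_(i < N) Y (2 * d - m - 2 - i%:Z) (divpow E i a) b.
Proof.
move=> aN; rewrite /adj_homog (@fsbig_nat_ord _ N)// => i Ni.
by rewrite (divpowE_eq0 Ni aN) vprod0l.
Qed.

Lemma adj_homog_gr d e m a b f : gr A d a -> gr A e b -> e + m - d + 1 = f ->
  gr A f (adj_homog d m a b).
Proof.
move=> da eb <-; have [N aN] := Dstar_nilpotent a; rewrite (adj_homogE _ _ _ aN).
apply: (subspaceZ (gr_sub _)); apply: (subspace_sum (gr_sub _)) => i _.
by apply: (gr_vprod (gr_divpowE i da) eb); lia.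
Qed.

(* Adjoint of the identity (D a)(-1) = [D, a(-1)]. *)
Lemma adj_homog_D d a b : gr A d a ->
  adj_homog (d + 1) (- 1) (D a) b =
  adj_homog d (- 1) a (E b) - E (adj_homog d (- 1) a b).
Proof.
move=> da; have [N aN] := Dstar_nilpotent a.
have DaN : iter N.+1 E (D a) = 0.
  rewrite iterE_divpow (divpowE_D N da) !(divpowE_eq0 _ aN)//.
  by rewrite linear0 scaler0 addr0 scaler0.
rewrite (adj_homogE _ _ _ DaN) !(adj_homogE _ _ _ aN).
rewrite linearZ/= -scalerBr expfzDr ?oppr_eq0 ?oner_eq0// expr1z mulrN1 scaleNr.
rewrite -scalerN; congr (_ *: _).
rewrite [X in _ = _ - X]linear_sum -sumrB.
(* After the common sign is removed, both sides equal the sum of the [s i]; what is left over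
   telescopes, with no upper boundary term because [s N] is 0. *)
pose s (i : nat) := Y (2 * d - i%:Z) (divpow E i a) b.
have telescope (c : nat -> int) :
    - ((c 0%N)%:~R *: s 0%N) =
    \sum_(i < N) ((c i.+1)%:~R *: s i.+1 - (c i)%:~R *: s i).
  rewrite -(big_mkord xpredT (fun i => (c i.+1)%:~R *: s i.+1 - (c i)%:~R *: s i)).
  rewrite (telescope_sumr (fun i => (c i)%:~R *: s i))//.
  by rewrite {2}/s (divpowE_eq0 (leqnn N) aN) vprod0l scaler0 sub0r.
have stepS (i : nat) : Y (2 * (d + 1) - - 1 - 2 - i.+1%:Z) (divpow E i.+1 (D a)) b =
    (2 * d - i%:Z)%:~R *: (s i - s i.+1).
  rewrite (divpowE_D i da) vprodDl vprodZl vprod_Dl addrC scalerBr -scaleNr -mulrNz.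
  by congr (_ *: Y _ _ _ + _%:~R *: Y _ _ _); lia.
have step0 : Y (2 * (d + 1) - - 1 - 2 - 0%:Z) (divpow E 0 (D a)) b =
    - ((2 * d + 1 - 0%N%:Z)%:~R *: s 0%N).
  rewrite /s !divpow0 vprod_Dl -scaleNr -mulrNz.
  by congr (_%:~R *: Y _ _ _); lia.
have step i : Y (2 * d - - 1 - 2 - i%:Z) (divpow E i a) (E b) -
    E (Y (2 * d - - 1 - 2 - i%:Z) (divpow E i a) b) =
    s i - (i.+1%:~R *: s i.+1 - i%:~R *: s i).
  have addK (u v w : A) : u - (u + v + w) = - (v + w).
    by rewrite -addrA opprD addrA subrr add0r.
  rewrite (E_vprod _ _ (gr_divpowE i da)) divpowE_S vprodZl addK.
  rewrite (_ : Y (_ + 1) _ _ = s i); last by congr Y; lia.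
  rewrite (_ : Y _ (divpow E i.+1 a) b = s i.+1); last by congr Y; lia.
  rewrite (_ : 2 * _ - _ - 2 = - i.+1%:Z); last by lia.
  move: (s i) (s i.+1) => u v; rewrite mulrNz scaleNr opprD opprK.
  by rewrite -!pmulrn -nat1r !scalerDl !scale1r opprB addrA.
transitivity (\sum_(i < N) s i); last first.
  under [RHS]eq_bigr do rewrite step.
  by rewrite sumrB -(telescope Posz) scale0r oppr0 subr0.
(* The weights 2d + 1 - i start at the coefficient in [step0], and their differences with those in
   [stepS] leave exactly - [s i]. *)
rewrite big_ord_recl step0 (telescope (fun i : nat => 2 * d + 1 - i%:Z)).
rewrite -big_split -sumrN; apply: eq_bigr => i _ /=.
rewrite stepS.
move: (s i) (s i.+1) => u v.
rewrite (_ : 2 * d + 1 - (bump 0 i)%:Z = 2 * d - i%:Z); last by rewrite /bump; lia.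
rewrite (_ : 2 * d + 1 - i%:Z = 2 * d - i%:Z + 1); last by lia.
move: (2 * d - i%:Z) => q; rewrite intrD scalerDl scale1r scalerBr addrC addrA.
by rewrite subrK opprB addrC addKr.
Qed.

(** * Homogeneous components *)

Lemma component_eq (S : {fset int}) (f : int -> A) a :
  (forall d, gr A d (f d)) -> (forall d, d \notin S -> f d = 0) ->
  a = \sum_(d <- S) f d -> component a = f.
Proof.
move=> fgr f0 aE; rewrite /component; case: cid => g [gP guniq] /=.
apply: guniq; split=> //; last by rewrite (fsbigTE S).
apply: (@sub_finite_set _ _ [set` S]); last exact: finite_fset.
by move=> d /= fd; apply: contrapT => /negP/f0.
Qed.

(** Allowing every larger index set lets two elements be expanded over a common one, as linearity
    requires. *)
Lemma component_decomp a : exists S : {fset int},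
  (forall d, d \notin S -> component a d = 0) /\
  forall S' : {fset int}, (S `<=` S')%fset -> a = \sum_(d <- S') component a d.
Proof.
rewrite /component; case: cid => g [[_ gfin aE] _] /=.
have S0 d : d \notin fset_set [set d | g d <> 0] -> g d = 0.
  by rewrite in_fset_set// notin_setE/= => /contrapT.
exists (fset_set [set d | g d <> 0]); split=> // S' /fsubsetP SS'.
rewrite [LHS]aE (fsbigTE S')// => d dS'.
by apply: S0; apply: contra dS' => /SS'.
Qed.

Lemma component_homog d a : gr A d a ->
  component a = fun e => if e == d then a else 0.
Proof.
move=> da; apply: (@component_eq [fset d]%fset) => [e|e|].
- by case: eqP => [->//|_]; exact: subspace0 (gr_sub e).
- by rewrite inE => /negbTE ->.
- by rewrite big_seq_fset1 eqxx.
Qed.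

Lemma component0 d : component (0 : A) d = 0.
Proof. by rewrite (component_homog (subspace0 (gr_sub d))) eqxx. Qed.

Lemma component_linear d : linear (component (A := A) ^~ d).
Proof.
move=> c a b; have [S [aS SE]] := component_decomp a.
have [T [bT TE]] := component_decomp b.
suff -> : component (c *: a + b) = fun e => c *: component a e + component b e by [].
apply: (@component_eq (S `|` T)%fset) => [e|e|].
- apply: subspaceD (gr_sub e) _ _ _ (component_gr b e).
  exact: subspaceZ (gr_sub e) _ _ (component_gr a e).
- by rewrite inE negb_or => /andP[/aS -> /bT ->]; rewrite scaler0 addr0.
- by rewrite big_split/= -scaler_sumr -SE ?fsubsetUl// -TE ?fsubsetUr.
Qed.

Lemma component_act a b d : gr A 0 a ->
  component (Y (- 1) a b) d = Y (- 1) a (component b d).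
Proof.
move=> a0; have [S [bS SE]] := component_decomp b.
suff -> : component (Y (- 1) a b) = fun e => Y (- 1) a (component b e) by [].
apply: (@component_eq S) => [e|e|].
- by apply: (gr_vprod a0 (component_gr b e)); lia.
- by move=> /bS ->; rewrite linear0.
- by rewrite {1}(SE S)// linear_sum.
Qed.

(** * A membership test for the radical *)

Lemma proj0_rad_sub x : gr A 0 x -> @rad_sub k A x -> @rad_proj k A (proj0 x) = 0.
Proof.
move=> x0 xN; apply/eqP; rewrite -[0](linear0 (@rad_proj k A)) lquot_pi_eq subr0.
by apply/mem_set; rewrite /= (component_homog x0) eqxx.
Qed.

(** The form pairs only components of equal degree, so test vectors of degree [d] suffice. *)
Lemma radical_homog d a : gr A d a ->
  (forall b, gr A d b -> @rad_sub k A (adj_homog d (- 1) a b)) -> radical A a.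
Proof.
move=> da aN b; rewrite /inv_form fsbig1// => e _.
have adj0 y : adj (- 1) (0 : A) y = 0.
  rewrite /adj fsbig1// => i _.
  by rewrite component0 (@adj_homogE 0)// big_ord0 scaler0.
rewrite (component_homog da); have [->|ed] := eqVneq e d; last first.
  rewrite adj0; apply: proj0_rad_sub; first exact: subspace0 (gr_sub 0).
  exact: subspace0 (subspace_lspan _).
have -> : adj (- 1) a (component b d) = adj_homog d (- 1) a (component b d).
  rewrite /adj (fsbigTE [fset d]%fset) => [|i].
    by rewrite big_seq_fset1 (component_homog da) eqxx.
  rewrite inE (component_homog da) => /negbTE ->.
  by rewrite (@adj_homogE 0)// big_ord0 scaler0.
apply: proj0_rad_sub; last exact: aN _ (component_gr b d).
by apply: (adj_homog_gr da (component_gr b d)); lia.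
Qed.

(** * Zero radical: vanishing of negative degrees, D^*A_1 and DA_0 *)

Hypothesis rad0 : radical A = [set 0].

(** The vanishing of the radical enters the argument through this criterion. *)
Lemma homog_eq0 d a : gr A d a ->
  (forall b, gr A d b -> @rad_sub k A (adj_homog d (- 1) a b)) -> a = 0.
Proof. by move=> da /(radical_homog da); rewrite rad0. Qed.

Lemma rad_subP : subspace (@rad_sub k A). Proof. exact: subspace_lspan. Qed.

Lemma rad_sub_vprod a b : gr A 0 a -> gr A 1 b -> @rad_sub k A (Y (- 1) a (E b)).
Proof.
by move=> a0 b1; apply: sub_lspan; exists a => //; exists (E b) => //; exists b.
Qed.

Lemma rad_sub_E b : gr A 1 b -> @rad_sub k A (E b).
Proof. by move/(rad_sub_vprod (gr_one (sl2_ax A))); rewrite vprod_1one. Qed.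

(* For u in A_0 all terms (D^*^(i) u)(-1-i) of u(-1)^* have the form
   (D^(i) D^*^(i) u)(-1) with D^(i) D^*^(i) u in A_0. *)
Lemma rad_sub_adj0 a b : gr A 0 a -> gr A 1 b ->
  @rad_sub k A (adj_homog 0 (- 1) a (E b)).
Proof.
move=> a0 b1; have [N aN] := Dstar_nilpotent a; rewrite (adj_homogE _ _ _ aN).
apply: (subspaceZ rad_subP); apply: (subspace_sum rad_subP) => i _.
rewrite (_ : 2 * 0 - _ - 2 - _ = - 1 - i%:Z); last by lia.
rewrite -vprod_divpow_Dl//; apply: rad_sub_vprod b1.
apply: (subspaceZ (gr_sub 0)).
suff iterD j m x : gr A (m - j%:Z) x -> gr A m (iter j D x).
  by apply: iterD; apply: gr_divpowE.
elim: j m x => [|j IH] m x /=; first by rewrite subr0.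
by move=> mx; rewrite -[m](subrK 1); apply: gr_D; apply: IH; move: mx; congr gr; lia.
Qed.

(* <a|E b> = <D a|b> *)
Lemma rad_sub_adj_E d a b : gr A d a -> gr A (d + 1) b ->
  @rad_sub k A (adj_homog (d + 1) (- 1) (D a) b) <->
  @rad_sub k A (adj_homog d (- 1) a (E b)).
Proof.
move=> da db; rewrite (adj_homog_D b da).
have EN : @rad_sub k A (E (adj_homog d (- 1) a b)).
  by apply: rad_sub_E; apply: (adj_homog_gr da db); lia.
split=> [/(subspaceD rad_subP)/(_ EN)|]; first by rewrite subrK.
by move=> /(subspaceB rad_subP)/(_ EN).
Qed.

(** In negative degree b = D^* D c, so the pairing of [a] with [b] can be replaced by that of [D a]
    with [D c], one degree higher; the climb ends in degree 0 against D^*A_1. *)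
Lemma rad_sub_adj_neg (i : nat) a b :
  gr A (- i.+1%:Z) a -> gr A (- i.+1%:Z) b ->
  @rad_sub k A (adj_homog (- i.+1%:Z) (- 1) a b).
Proof.
have iS j : - j.+2%:Z + 1 = - j.+1%:Z by lia.
elim: i a b => [|i IH] a b da db.
  have [//|c dc ->] := neg_ED_surj _ db.
  have [//|c' dc' cE] := neg_ED_surj _ dc.
  have D1 := gr_D da; have Dc := gr_D dc; have Dc' := gr_D dc'.
  rewrite !addNr in D1 Dc Dc'.
  apply/rad_sub_adj_E => //; rewrite addNr.
  (* [D c'] has degree 0, where D^* and D commute, so D c = D D^* D c' = D^* D (D c') lies in
     D^*A_1. *)
  have := E_D Dc'; rewrite mulr0 mulr0z scale0r addr0 -cE => <-.
  by apply: rad_sub_adj0 D1 _; have := gr_D Dc'; rewrite add0r.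
have [//|c dc ->] := neg_ED_surj _ db.
apply/rad_sub_adj_E => //; first exact: gr_D.
by rewrite iS; apply: IH; rewrite -iS; exact: gr_D.
Qed.

Lemma gr_neg d a : d < 0 -> gr A d a -> a = 0.
Proof.
case: d => // i _; rewrite NegzE => da.
by apply: (homog_eq0 da) => b; exact: rad_sub_adj_neg.
Qed.

(** The product has negative degree -s - 1. *)
Lemma vprod_gr0_ge0 a b (s : nat) : gr A 0 a -> gr A 0 b -> Y s a b = 0.
Proof.
by move=> a0 b0; apply: (@gr_neg (- s%:Z - 1)); [lia|apply: (gr_vprod a0 b0); lia].
Qed.

(** Skew symmetry, whose correction sum is empty by [vprod_gr0_ge0]. *)
Lemma vprod_gr0C a b : gr A 0 a -> gr A 0 b -> Y (- 1) a b = Y (- 1) b a.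
Proof.
move=> a0 b0; rewrite (@vprod_skew _ _ _ _ _ 0) => [|s _]; last exact: vprod_gr0_ge0.
by rewrite big_ord0 subr0 vprodN1_one.
Qed.

Lemma adj_homog0 a b : gr A 0 a -> adj_homog 0 (- 1) a b = Y (- 1) a b.
Proof.
move=> a0; rewrite (@adj_homogE 1).
  by rewrite big_ord1 divpow0 expr0z scale1r.
by apply: (gr_neg _ (gr_E a0)).
Qed.

(** By commutativity the pairing of [E b] with [x] is the class of x(-1)D^*b, a generator of the
    subspace factored out. *)
Lemma E_gr1 b : gr A 1 b -> E b = 0.
Proof.
move=> b1; have Eb0 := gr_E b1; rewrite subrr in Eb0.
apply: (homog_eq0 Eb0) => x x0.
by rewrite adj_homog0// vprod_gr0C//; exact: rad_sub_vprod.
Qed.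

(** <Da|b> = <a|D^*b>, and D^*b = 0 by [E_gr1]. All results on elements killed by [D] now apply to
    A_0. *)
Lemma D_gr0 a : gr A 0 a -> D a = 0.
Proof.
move=> a0; apply: (homog_eq0 (gr_D a0)) => b b1.
apply/(rad_sub_adj_E a0 b1); move: b1; rewrite add0r => /E_gr1 ->.
by rewrite adj_homog0// linear0; exact: subspace0 rad_subP.
Qed.

(** Both correction terms of the commutator vanish: a(0) = 0, and D^*a has degree -1. *)
Lemma E_act a x : gr A 0 a -> E (Y (- 1) a x) = Y (- 1) a (E x).
Proof.
move=> a0; rewrite (E_vprod _ _ a0) (vprod_const char0 (D_gr0 a0) x (n := - 1 + 1))//.
by rewrite (gr_neg _ (gr_E a0))// vprod0l scaler0 !addr0.
Qed.

(** * Ideals and their intersection with A_0 *)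

Section Ideal.
Variable I : set A.
Hypothesis idI : va_ideal I.

Let sI : subspace I := ideal_subspace idI.

(* [D^*, D] acts on A_d as multiplication by 2d and preserves I, so Lagrange
   elimination separates the components. *)
Lemma ideal_sum_homog (r : seq int) (f : int -> A) : uniq r ->
  (forall d, gr A d (f d)) -> I (\sum_(d <- r) f d) -> forall d, d \in r -> I (f d).
Proof.
elim: r f => //= e r IH f /andP[er ru] fgr => Ief.
have Ir d : d \in r -> I (f d).
  move=> dr; have de : d != e by apply: contraNneq er => <-.
  have c0 : (2 * (d - e))%:~R != 0 :> k.
    by rewrite (pchar0_intr_eq0 char0); move: de; lia.
  rewrite -[f d](scalerK c0); apply: (subspaceZ sI).
  apply: (IH (fun d => (2 * (d - e))%:~R *: f d) ru _ _ d dr) => [i|].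
    exact: (subspaceZ (gr_sub i) _ (fgr i)).
  set a := \sum_(d <- _) f d in Ief.
  (* [D^*, D] - 2e kills the term of degree [e] and scales the one of degree [i] by 2(i - e), so the
     induction hypothesis applies to the rest. *)
  have -> : \sum_(i <- r) (2 * (i - e))%:~R *: f i =
      E (D a) - D (E a) - (2 * e)%:~R *: a.
    have EDf i : E (D (f i)) - D (E (f i)) - (2 * e)%:~R *: f i =
        (2 * (i - e))%:~R *: f i.
      by rewrite (E_D (fgr i)) [D _ + _]addrC addrK -scalerBl -intrB mulrBr.
    rewrite /a [D (\sum_(_ <- _) _)]linear_sum [in RHS]linear_sum.
    rewrite [E (\sum_(_ <- _) f _)]linear_sum [D (\sum_(_ <- _) _)]linear_sum.
    rewrite scaler_sumr -!sumrB big_cons.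
    by rewrite EDf subrr mulr0 scale0r add0r; apply: eq_bigr => i _; rewrite EDf.
  apply: (subspaceB sI); last exact: subspaceZ.
  apply: (subspaceB sI); first exact/(ideal_Dstar idI)/(ideal_D idI).
  exact/(ideal_D idI)/(ideal_Dstar idI).
move=> d; rewrite inE => /orP[/eqP ->|/Ir//].
rewrite -[f e](addrK (\sum_(i <- r) f i)); apply: (subspaceB sI).
  by move: Ief; rewrite big_cons.
by rewrite big_seq; exact: (subspace_sum sI).
Qed.

Lemma ideal_component a d : I a -> I (component a d).
Proof.
move=> Ia; have [S [aS SE]] := component_decomp a.
have [dS|/aS ->] := boolP (d \in S); last exact: subspace0 sI.
apply: (@ideal_sum_homog S (component a)) => //.
- exact: fset_uniq.
- exact: component_gr.
- by rewrite -(SE S).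
Qed.

(** Components of elements of [I] lie in [I], and pairing one with any [b] gives the class of an
    element of [I] in A_0, hence 0. *)
Lemma ideal_eq0 : I `&` gr A 0 = [set 0] -> I = [set 0].
Proof.
move=> I0; apply/seteqP; split=> [a Ia|_ ->]; last exact: subspace0 sI.
have [S [_ /(_ S (fsubset_refl S)) /= ->]] := component_decomp a.
apply: big1_seq => d _; have Iad := ideal_component d Ia.
have da := component_gr a d; apply: (homog_eq0 da) => b db.
suff -> : adj_homog d (- 1) (component a d) b = 0 by exact: subspace0 rad_subP.
suff: (I `&` gr A 0) (adj_homog d (- 1) (component a d) b) by rewrite I0.
split; last by apply: (adj_homog_gr da db); lia.
have [N aN] := Dstar_nilpotent (component a d); rewrite (adj_homogE _ _ _ aN).
apply: (subspaceZ sI); apply: (subspace_sum sI) => i _.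
apply: (ideal_prodr idI); apply: (subspaceZ sI).
by elim: (i : nat) => //= j; exact: ideal_Dstar.
Qed.

End Ideal.

Lemma ideal_vone (I : set A) : va_ideal I -> I (vone A) -> I = [set: A].
Proof.
move=> idI I1; apply/seteqP; split=> // a _.
by rewrite -[a]vprod_1one; exact: (ideal_prodr idI).
Qed.

(** * The algebra A_0, its action on A, and simplicity *)

Lemma deg0_com_algebraP : deg0_com_algebra A.
Proof.
split=> [|a b a0 b0|a b c a0 b0 c0|||a a0].
- exact: gr_sub.
- by apply: (gr_vprod a0 b0); lia.
- by rewrite (const_assoc char0 (D_gr0 a0)).
- exact: vprod_gr0C.
- exact: gr_one (sl2_ax A).
- by rewrite vprod_1one vprodN1_one.
Qed.

Lemma vertex_algebra_over_deg0P : vertex_algebra_over_deg0 A.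
Proof.
split=> [d|m b|m a||].
- split=> [a b a0 db|a a' b _ _ _|a b b' _ _ _|a a' b a0 _ _|b _].
  + by apply: (gr_vprod a0 db); lia.
  + exact: vprodDl.
  + exact: linearD.
  + by rewrite (const_assoc char0 (D_gr0 a0)).
  + exact: vprod_1one.
- by split=> [|a x a0]; [exact: vprodDl|rewrite (const_assoc char0 (D_gr0 a0))].
- by split=> [|b x b0]; [exact: linearD|rewrite (const_comm char0 (D_gr0 b0))].
- by split=> [|a x a0]; [exact: linearD|rewrite (const_D (D_gr0 a0))].
- by split=> [|a x a0]; [exact: linearD|exact: E_act].
Qed.

Lemma prod_span_min (X Z W : set A) : subspace W ->
  (forall x z, X x -> Z z -> W (Y (- 1) x z)) -> prod_span X Z `<=` W.
Proof. by move=> sW XZW; apply: (lspan_min sW) => _ [x Xx [z Zz <-]]; exact: XZW. Qed.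

Lemma prod_span_in (X Z : set A) x z : X x -> Z z -> prod_span X Z (Y (- 1) x z).
Proof. by move=> Xx Zz; apply: sub_lspan; exists x => //; exists z. Qed.

Lemma preimage_subspace (V W : lmodType k) (f : V -> W) (X : set W) :
  linear f -> subspace X -> subspace (f @^-1` X).
Proof.
move=> lf sX; pose F : {linear V -> W} := HB.pack f (GRing.isLinear.Build k V W _ f lf).
have f0 : f 0 = 0 := linear0 F.
split; first by rewrite /preimage/= f0; exact: subspace0 sX.
by move=> c x y Xx Xy; rewrite /preimage/= lf; exact: sX.2.
Qed.

(** For x in [J] all structure maps commute with x(-1), so stability holds on the generators x(-1)z
    and extends by minimality of the span. *)
Lemma deg0_ideal_prod_span (J : set A) : deg0_ideal J ->
  va_ideal (prod_span J [set: A]) /\ prod_span J [set: A] `&` gr A 0 = J.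
Proof.
move=> idJ; have J0 := deg0_ideal_sub idJ.
pose JA := prod_span J [set: A].
have sJA : subspace JA by exact: subspace_lspan.
have const x : J x -> D x = 0 by move/J0/D_gr0.
split; first split=> // [n a|n a b|a|a].
- apply: (@prod_span_min _ _ (Y n a @^-1` JA)) => [|x z Jx _].
    by apply: preimage_subspace sJA; exact: linearP.
  by rewrite /preimage/= (const_comm char0 (const x Jx)); exact: prod_span_in.
- apply: (@prod_span_min _ _ (Y n ^~ b @^-1` JA)) => [|x z Jx _].
    by apply: preimage_subspace sJA; exact: va_linearl (va_axioms A) n b.
  by rewrite /preimage/= (const_assoc char0 (const x Jx)); exact: prod_span_in.
- apply: (@prod_span_min _ _ (D @^-1` JA)) => [|x z Jx _].
    by apply: preimage_subspace sJA; exact: linearP.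
  by rewrite /preimage/= (const_D (const x Jx)); exact: prod_span_in.
- apply: (@prod_span_min _ _ (E @^-1` JA)) => [|x z Jx _].
    by apply: preimage_subspace sJA; exact: linearP.
  by rewrite /preimage/= (E_act _ (J0 x Jx)); exact: prod_span_in.
(* Projecting x(-1)z to degree 0 gives x(-1)z_0, which is in [J]; elements of A_0 are their own
   projection. *)
have compJ : JA `<=` (component (A := A) ^~ 0) @^-1` J.
  apply: prod_span_min => [|x z Jx _].
    exact: preimage_subspace (component_linear 0) (deg0_ideal_subspace idJ).
  have z0 := component_gr z 0.
  rewrite /preimage/= (component_act _ _ (J0 x Jx)) (vprod_gr0C (J0 x Jx) z0).
  exact: (deg0_ideal_mul idJ).
apply/seteqP; split=> [a [/compJ + a0]|x Jx].
  by rewrite /preimage/= (component_homog a0) eqxx.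
by split; [rewrite -[x]vprodN1_one; exact: prod_span_in|exact: J0].
Qed.

Lemma deg0_principal_ideal a : gr A 0 a -> deg0_ideal (Y (- 1) ^~ a @` gr A 0).
Proof.
move=> a0; split=> [_ [b b0 <-]||b _ b0 [c c0 <-]].
- by apply: (gr_vprod b0 a0); lia.
- split.
    by exists 0; [exact: subspace0 (gr_sub 0)|rewrite vprod0l].
  move=> c _ _ [b b0 <-] [b' b'0 <-]; exists (c *: b + b').
    by apply: (gr_sub 0).2.
  exact: va_linearl (va_axioms A) _ _ _ _ _.
- exists (Y (- 1) b c); first by apply: (gr_vprod b0 c0); lia.
  by rewrite (const_assoc char0 (D_gr0 b0)).
Qed.

(** If A is simple, the ideal generated by A_0 a with a nonzero in A_0 is A, so 1 lies in A_0 a.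
    Conversely, a nonzero ideal meets A_0 in an invertible element and so contains 1. *)
Lemma va_simple_deg0_field : va_simple A <-> deg0_field A.
Proof.
split=> [[[x x0] simpleA]|[_ one0 invA]].
- split; first exact: deg0_com_algebraP.
    by move=> one0; apply: x0; rewrite -[x]vprod_1one one0 vprod0l.
  move=> a a0 an0; have idJ := deg0_principal_ideal a0.
  have [idJA JA0] := deg0_ideal_prod_span idJ.
  have Ja : (Y (- 1) ^~ a @` gr A 0) a.
    by exists (vone A); [exact: gr_one (sl2_ax A)|exact: vprod_1one].
  have [JA|JA] := simpleA _ idJA.
    by move: Ja; rewrite -JA0 JA => -[].
  suff : (Y (- 1) ^~ a @` gr A 0) (vone A).
    by move=> [b b0 ba1]; exists b => //; rewrite vprod_gr0C.
  by rewrite -JA0 JA; split=> //; exact: gr_one (sl2_ax A).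
- split; first by exists (vone A).
  move=> I idI; have [/(ideal_eq0 idI) ->|I0] := pselect (I `&` gr A 0 = [set 0]).
    by left.
  right; apply: (ideal_vone idI).
  have [a [Ia a0] an0] : exists2 a, (I `&` gr A 0) a & a <> 0.
    apply: contrapT => nex; apply: I0; apply/seteqP; split=> [a Ia|_ ->].
      by apply: contrapT => an0; apply: nex; exists a.
    split; [exact: subspace0 (ideal_subspace idI)|exact: subspace0 (gr_sub 0)].
  have [b _ <-] := invA a a0 an0.
  exact: (ideal_prodr idI).
Qed.

End Graded.

Theorem theorem2 (k : fieldType) (char0 : [pchar k] =i pred0)
    (A : sl2VertexAlgebra k) (radA0 : radical A = [set 0]) :
  [/\ forall d : int, d < 0 -> gr A d = [set 0],
      deg0_com_algebra A,
      vertex_algebra_over_deg0 A,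
      forall I : set A, va_ideal I -> (I `&` gr A 0 = [set 0] <-> I = [set 0])
    & (forall J0 : set A, deg0_ideal J0 ->
         va_ideal (prod_span J0 [set: A]) /\
         prod_span J0 [set: A] `&` gr A 0 = J0) /\
      (va_simple A <-> deg0_field A)].
Proof.
split=> [d d0|||I idI|].
- apply/seteqP; split=> [a da|_ ->]; first exact: (gr_neg char0 radA0 d0 da).
  exact: subspace0 (gr_sub A d).
- exact: deg0_com_algebraP.
- exact: vertex_algebra_over_deg0P.
- split=> [|->]; first exact: ideal_eq0.
  by rewrite setIidl// => _ ->; exact: subspace0 (gr_sub A 0).
- by split; [exact: deg0_ideal_prod_span|exact: va_simple_deg0_field].
Qed.
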